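(* Let $T>0$, $\mathbf{y}_0\in\mathbb{R}^N$, and let $\mathbf{F}:\mathbb{R}\times\mathbb{R}^N\to\mathbb{R}^N$ be continuous and locally Lipschitz continuous with respect to the second argument. Let $\mathbf{y}\in C^1([0,T];\mathbb{R}^N)$ be a solution of $\mathbf{y}'(t)=\mathbf{F}(t,\mathbf{y}(t))$ for all $t\in[0,T]$, $\mathbf{y}(0)=\mathbf{y}_0$. Then there exist two constants $C,C'>0$ depending only on $T$, $\mathbf{F}$ and $\mathbf{y}$ such that the following holds: if $\boldsymbol{\eta}:\mathbb{R}\to\mathbb{R}^N$ is a network with an architecture of type (A) satisfying $$\mathrm{Loss}(\boldsymbol{\eta};\mathcal{E}_{\mathrm{var}},\mathcal{E}_{\mathrm{step}},\mathcal{E}_{\mathrm{int}})\le\mathcal{E}_{\mathrm{loss}}$$ and $\mathcal{E}_{\mathrm{loss}}+K_t\mathcal{E}_{\mathrm{int}}+\mathcal{E}_{\mathrm{var}}+\mathcal{E}_{\mathrm{step}}<C'$, then for all $t\in[0,T]$ $$|\boldsymbol{\eta}(t)-\mathbf{y}(t)|\le C\big(\mathcal{E}_{\mathrm{loss}}+K_t\mathcal{E}_{\mathrm{int}}+\mathcal{E}_{\mathrm{var}}+\mathcal{E}_{\mathrm{step}}\big).$$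
   Context: Local Lipschitz continuity in the second argument means: each $(t,x)\in\mathbb{R}\times\mathbb{R}^N$ has a neighborhood on which $\mathbf{F}$ is Lipschitz continuous in the second argument. A network with architecture of type (A) (here with input dimension $d=1$ and output dimension $N$), with $L$ hidden layers and nondecreasing activation function $\sigma:\mathbb{R}\to\mathbb{R}$, is a map $\boldsymbol{\eta}(z)=\sum_{i=1}^K\eta_i(\mathbf{s}_i\odot z)$ with $\mathbf{s}_i\in\{-1,1\}^d$, $\odot$ componentwise multiplication, and $\eta_i(z)=A_{L+1,i}\hat\sigma(A_{L,i}\hat\sigma(\cdots\hat\sigma(A_{1,i}z+b_{1,i})\cdots)+b_{L,i})+b_{L+1,i}$, where $\hat\sigma$ is $\sigma$ applied componentwise, all matrices $A_{l,i}$ ($l=1,\dots,L+1$) have nonnegative real entries and, together with the real vectors $b_{l,i}$, compatible sizes. Its estimated M-variation is the vector $\operatorname{EMVar}(\boldsymbol{\eta};U)=\sum_{i=1}^K(\sup_{z\in U}\eta_i(\mathbf{s}_i\odot z)-\inf_{z\in U}\eta_i(\mathbf{s}_i\odot z))$, with sup and inf taken componentwise. For tolerances $\mathcal{E}_{\mathrm{var}},\mathcal{E}_{\mathrm{step}},\mathcal{E}_{\mathrm{int}}>0$ let $0=t_0<t_1<\dots<t_{K_t}=T$ be a partition (depending on $\boldsymbol{\eta},\mathcal{E}_{\mathrm{var}},\mathcal{E}_{\mathrm{step}}$) such that for all $k=1,\dots,K_t$: (1) $\operatorname{EMVar}(\boldsymbol{\eta};[t_{k-1},t_k])\le\mathcal{E}_{\mathrm{var}}$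 (in each component); and (2) $\int_{t_{k-1}}^{t_k}|\mathbf{F}(s,\boldsymbol{\eta}(s))|\,ds\le\mathcal{E}_{\mathrm{step}}$ or $t_k-t_{k-1}\le\mathcal{E}_{\mathrm{step}}$. Let $I_{\mathcal{E}_{\mathrm{int}}}[\mathbf{F}(\cdot,\boldsymbol{\eta}(\cdot));a,b]$ denote an approximation with $\big|I_{\mathcal{E}_{\mathrm{int}}}[\mathbf{F}(\cdot,\boldsymbol{\eta}(\cdot));a,b]-\int_a^b\mathbf{F}(s,\boldsymbol{\eta}(s))\,ds\big|\le\mathcal{E}_{\mathrm{int}}$. The loss is $$\mathrm{Loss}(\boldsymbol{\eta};\mathcal{E}_{\mathrm{var}},\mathcal{E}_{\mathrm{step}},\mathcal{E}_{\mathrm{int}})=\sum_{k=1}^{K_t}\big|\boldsymbol{\eta}(t_k)-\boldsymbol{\eta}(t_{k-1})-I_{\mathcal{E}_{\mathrm{int}}}[\mathbf{F}(\cdot,\boldsymbol{\eta}(\cdot));t_{k-1},t_k]\big|+|\boldsymbol{\eta}(0)-\mathbf{y}_0|.$$ $|\cdot|$ is the Euclidean norm on $\mathbb{R}^N$. *)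

(* Defs.v *)
From HB Require Import structures.
From mathcomp Require Import all_boot all_order all_algebra.
From mathcomp Require Import all_classical all_reals all_analysis.
Import Order.TTheory GRing.Theory Num.Theory.
Import numFieldNormedType.Exports.

Set Implicit Arguments.
Unset Strict Implicit.
Unset Printing Implicit Defensive.

Local Open Scope classical_set_scope.
Local Open Scope ring_scope.

(* The library norm on matrices is the max norm, hence this definition; both
   norms induce the same topology on 'cV[R]_N. *)
Definition enorm {R : realType} {N : nat} (v : 'cV[R]_N) : R :=
  Num.sqrt (\sum_(j < N) v j 0 ^+ 2).

Definition loc_lipschitz_snd {R : realType} {N : nat}
    (F : R * 'cV[R]_N -> 'cV[R]_N) : Prop :=
  forall p : R * 'cV[R]_N, exists U : set (R * 'cV[R]_N), exists k : R,
    nbhs p U /\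
    forall (t : R) (x x' : 'cV[R]_N), U (t, x) -> U (t, x') ->
      enorm (F (t, x) - F (t, x')) <= k * enorm (x - x').

(* Derivative relative to A: one-sided at the endpoints of an interval. *)
Definition has_deriv_within {R : realType} {N : nat} (A : set R)
    (f : R -> 'cV[R]_N) (t : R) (v : 'cV[R]_N) : Prop :=
  (s - t)^-1 *: (f s - f t) @[s --> within A t^'] --> v.

Definition C1_on {R : realType} {N : nat} (A : set R)
    (f : R -> 'cV[R]_N) : Prop :=
  exists g : R -> 'cV[R]_N, {within A, continuous g} /\
    forall t, A t -> has_deriv_within A f t (g t).

(* [mlp R L m n]: affine maps A_1 z + b_1, ..., A_{L+1} z + b_{L+1}, the first
   with input dimension m, the last with output dimension n; the widths of the
   L hidden layers are free. *)
Inductive mlp (R : realType) : nat -> nat -> nat -> Type :=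
| mlp_out (m n : nat) (A : 'M[R]_(n, m)) (b : 'cV[R]_n) : mlp R 0 m n
| mlp_hid (L m p n : nat) (A : 'M[R]_(p, m)) (b : 'cV[R]_p)
    (q : mlp R L p n) : mlp R L.+1 m n.

Fixpoint mlp_eval {R : realType} (sigma : R -> R) {L m n : nat}
    (q : mlp R L m n) : 'cV[R]_m -> 'cV[R]_n :=
  match q in mlp _ L' m' n' return 'cV[R]_m' -> 'cV[R]_n' with
  | mlp_out _ _ A b => fun z => A *m z + b
  | mlp_hid _ _ _ _ A b q' =>
      fun z => mlp_eval sigma q' (map_mx sigma (A *m z + b))
  end.

Fixpoint mlp_nonneg {R : realType} {L m n : nat} (q : mlp R L m n) : Prop :=
  match q with
  | mlp_out _ _ A _ => forall i j, 0 <= A i j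
  | mlp_hid _ _ _ _ A _ q' => (forall i j, 0 <= A i j) /\ mlp_nonneg q'
  end.

(* Networks of type (A) with L hidden layers, input dimension d and output
   dimension N.  The decomposition into monotone subnetworks is part of the
   data, since EMVar depends on it and not only on the represented map. *)
Record netA (R : realType) (L d N : nat) := NetA {
  netA_size : nat;
  netA_sign : 'I_netA_size -> 'cV[R]_d;
  netA_sub : 'I_netA_size -> mlp R L d N;
  netA_signP : forall i j, netA_sign i j 0 = 1 \/ netA_sign i j 0 = -1;
  netA_subP : forall i, mlp_nonneg (netA_sub i) }.

Definition netA_term {R : realType} (sigma : R -> R) {L d N : nat}
    (eta : netA R L d N) (i : 'I_(netA_size eta)) (z : 'cV[R]_d) : 'cV[R]_N :=
  mlp_eval sigma (netA_sub i) (map2_mx *%R (netA_sign i) z).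

Definition netA_eval {R : realType} (sigma : R -> R) {L d N : nat}
    (eta : netA R L d N) (z : 'cV[R]_d) : 'cV[R]_N :=
  \sum_(i < netA_size eta) netA_term sigma i z.

Definition netA_map {R : realType} (sigma : R -> R) {L N : nat}
    (eta : netA R L 1 N) (t : R) : 'cV[R]_N :=
  netA_eval sigma eta (const_mx t).

(* [sup] and [inf] are those of R; they are meaningful when U is nonempty and
   the terms are bounded on it, as on segments for nondecreasing sigma. *)
Definition EMVar {R : realType} (sigma : R -> R) {L d N : nat}
    (eta : netA R L d N) (U : set 'cV[R]_d) : 'cV[R]_N :=
  \sum_(i < netA_size eta) \col_(j < N)
    (sup [set netA_term sigma i z j 0 | z in U] -
     inf [set netA_term sigma i z j 0 | z in U]).

Definition vintegral {R : realType} {N : nat} (a b : R)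
    (f : R -> 'cV[R]_N) : 'cV[R]_N :=
  \col_(j < N) Rintegral lebesgue_measure `[a, b] (fun s => f s j 0).

(* A partition 0 = t_0 < ... < t_K = T is the sequence s = [:: t_1; ...; t_K],
   as in [itv_partition]. *)
Definition node {R : realType} (s : seq R) (k : nat) : R := nth 0 (0 :: s) k.

Definition admissible_partition {R : realType} {N : nat} (T : R)
    (F : R * 'cV[R]_N -> 'cV[R]_N) (sigma : R -> R) {L : nat}
    (eta : netA R L 1 N) (Evar Estep : R) (s : seq R) : Prop :=
  itv_partition 0 T s /\
  forall k : nat, (k < size s)%N ->
    (forall j, EMVar sigma eta
                 [set const_mx z | z in `[node s k, node s k.+1]] j 0
               <= Evar) /\
    (Rintegral lebesgue_measure `[node s k, node s k.+1]
       (fun z => enorm (F (z, netA_map sigma eta z))) <= Estep \/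
     node s k.+1 - node s k <= Estep).

(* [I a b] stands for the approximate value of the integral over [a, b] of
   F(., eta(.)); only its values on the partition intervals occur. *)
Definition approx_integral {R : realType} {N : nat}
    (F : R * 'cV[R]_N -> 'cV[R]_N) (sigma : R -> R) {L : nat}
    (eta : netA R L 1 N) (Eint : R) (s : seq R)
    (I : R -> R -> 'cV[R]_N) : Prop :=
  forall k : nat, (k < size s)%N ->
    enorm (I (node s k) (node s k.+1) -
           vintegral (node s k) (node s k.+1)
             (fun z => F (z, netA_map sigma eta z))) <= Eint.

Definition Loss {R : realType} {N : nat} (y0 : 'cV[R]_N) (sigma : R -> R)
    {L : nat} (eta : netA R L 1 N) (s : seq R)
    (I : R -> R -> 'cV[R]_N) : R :=
  \sum_(k < size s)
     enorm (netA_map sigma eta (node s k.+1) - netA_map sigma eta (node s k)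
            - I (node s k) (node s k.+1))
  + enorm (netA_map sigma eta 0 - y0).

(* Main.v *)
Require Import Defs.
From mathcomp Require Import all_boot all_order all_algebra.
From mathcomp Require Import all_classical all_reals all_analysis.
From mathcomp Require Import measurable_realfun.
From mathcomp Require Import ring lra.
Import Order.TTheory GRing.Theory Num.Theory.
Import numFieldNormedType.Exports.
Local Open Scope classical_set_scope.
Local Open Scope ring_scope.

Set Implicit Arguments.
Unset Strict Implicit.
Unset Printing Implicit Defensive.

(** The proof is a continuous Gronwall argument for the error [eta - y], run
    component by component on the partition.

    Up to a node [t_k], telescoping turns the loss and the quadrature errors
    into [Eloss + k * Eint], and what remains is the integral over [0, t_k] of
    [F (s, eta s) - F (s, y s)] ([error_at_node]).  From the last node up to an
    arbitrary [t], [eta] moves by at most [Evar] because each monotone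
    subnetwork moves by at most its variation ([netA_map_oscillation]), while
    [y] moves by the integral of [F (s, y s)]: this is a multiple of [Estep]
    when the subinterval is short, and otherwise it is compared with the
    integral of [|F (s, eta s)|] at the price of the same difference
    [F (s, eta s) - F (s, y s)] ([error_partial_step]).  With [delta] the sum of
    the tolerances, a Lipschitz bound around the graph of [y] therefore gives
    [|eta t - y t| <= const * (delta + \int_0^t |eta s - y s| ds)] as long as
    [eta] has stayed close to [y].

    The Lipschitz bound holds on a tube around the compact graph of [y]
    ([lipschitz_tube]), so one must also show that [eta], which may jump, never
    leaves the tube.  Both goals are reached at once by [real_induction] on the
    claim [|eta t - y t| <= B * exp (c * t)] with [B] proportional to [delta].
    If the claim holds before [t], integrating the exponential with a large [c]
    improves the bound at [t] by a factor of two
    ([error_improvement]); the slack absorbs the variation of [eta] and of [y]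
    just after [t].  Smallness of [delta] keeps [B * exp (c * T)] below the
    radius of the tube.

    For these integrals to be meaningful, [s |-> F (s, eta s)] has to be
    integrable although [eta] is only a sum of monotone functions; this is
    [integrable_continuous_comp]. *)

(** * Euclidean norm and monotone networks *)

Lemma norm_coord_le_enorm (R : realType) (N : nat) (v : 'cV[R]_N) (j : 'I_N) :
  `|v j 0| <= enorm v.
Proof.
rewrite -sqrtr_sqr; apply: ler_wsqrtr.
by rewrite (bigD1 j)//= lerDl sumr_ge0// => i _; rewrite sqr_ge0.
Qed.

Lemma enorm_ge0 (R : realType) (N : nat) (v : 'cV[R]_N) : 0 <= enorm v.
Proof. exact: sqrtr_ge0. Qed.

(** The factor [N] is cruder than [sqrt N]; it lets all later estimates be made on
    single components. *)
Lemma enorm_le (R : realType) (N : nat) (v : 'cV[R]_N) (a : R) :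
  0 <= a -> (forall j, `|v j 0| <= a) -> enorm v <= N%:R * a.
Proof.
move=> a0 va; rewrite -(@ger0_norm _ (N%:R * a)) ?mulr_ge0// -sqrtr_sqr.
apply: ler_wsqrtr.
rewrite (@le_trans _ _ (\sum_(j < N) a ^+ 2))//.
  apply: ler_sum => j _; rewrite -(real_normK (num_real (v j 0))).
  by rewrite lerXn2r// nnegrE.
rewrite sumr_const card_ord -[leLHS]mulr_natl exprMn ler_wpM2r ?sqr_ge0//.
by rewrite -natrX ler_nat; case: (N) => // n; rewrite expnS leq_pmulr.
Qed.

Lemma mx_norm_le (R : realType) (N : nat) (v : 'cV[R]_N) (e : R) :
  0 <= e -> (forall j, `|v j 0| <= e) -> `|v| <= e.
Proof.
move=> e0 ve; have [->|v0] := eqVneq v 0; first by rewrite normr0.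
have [|[i k] /= vE] := @mx_norm_neq0 _ _ _ v.
  by apply: contra_neq v0 => /mx_norm_eq0.
by rewrite [`|v|]vE (ord1 k).
Qed.

Lemma coord_le_mx_norm (R : realType) (N : nat) (v : 'cV[R]_N) (j : 'I_N) :
  `|v j 0| <= `|v|.
Proof.
rewrite [`|v|]mx_normrE.
by apply: (le_bigmax _ (fun ij : 'I_N * 'I_1 => `|v ij.1 ij.2|) (j, 0)).
Qed.

(** Nonnegative matrices and a nondecreasing activation preserve the
    componentwise order, layer by layer. *)
Lemma mlp_eval_homo (R : realType) (sigma : R -> R) (L m n : nat)
    (q : mlp R L m n) (z z' : 'cV[R]_m) :
  {homo sigma : u v / u <= v} -> mlp_nonneg q ->
  (forall j, z j 0 <= z' j 0) ->
  forall i, mlp_eval sigma q z i 0 <= mlp_eval sigma q z' i 0.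
Proof.
move=> hs; elim: q z z' => [m' n' A b|L' m' p n' A b q IH] z z' /=.
  move=> A0 zz' i; rewrite !mxE lerD2r; apply: ler_sum => j _.
  by rewrite ler_wpM2l.
move=> [A0 q0] zz' i; apply: IH => // j; rewrite !mxE; apply: hs.
by rewrite lerD2r; apply: ler_sum => k _; rewrite ler_wpM2l.
Qed.

(** In dimension one the sign vector of a subnetwork is [1] or [-1], so that the
    subnetwork is nondecreasing or nonincreasing in [t]. *)
Lemma netA_term_monotone (R : realType) (sigma : R -> R) (L N : nat)
    (eta : netA R L 1 N) (i : 'I_(netA_size eta)) (j : 'I_N) :
  {homo sigma : u v / u <= v} ->
  let f := fun t : R => netA_term sigma i (const_mx t) j 0 in
  nondecreasing_fun f \/ nonincreasing_fun f.
Proof.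
move=> hs f; have [si|si] := netA_signP i 0; [left|right] => s t st;
  apply: mlp_eval_homo => //; try exact: netA_subP; move=> k;
  by rewrite (ord1 k) !mxE si; lra.
Qed.

Lemma monotone_bounded (R : realType) (f : R -> R) (a b t : R) :
  nondecreasing_fun f \/ nonincreasing_fun f -> a <= t <= b ->
  Num.min (f a) (f b) <= f t <= Num.max (f a) (f b).
Proof.
move=> [] mf /andP[/mf fa /mf fb]; rewrite ge_min le_max fa fb ?orbT//.
Qed.

(** Monotone terms are bounded on a segment, so the suprema and infima in [EMVar]
    are genuine and dominate the oscillation of every term. *)
Lemma netA_map_oscillation (R : realType) (sigma : R -> R) (L N : nat)
    (eta : netA R L 1 N) (a b s t : R) (j : 'I_N) :
  {homo sigma : u v / u <= v} -> a <= s <= b -> a <= t <= b ->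
  `|netA_map sigma eta s j 0 - netA_map sigma eta t j 0| <=
  EMVar sigma eta [set const_mx z | z in `[a, b]] j 0.
Proof.
move=> hs sab tab; rewrite /netA_map /netA_eval /EMVar !summxE -sumrB.
rewrite (le_trans (ler_norm_sum _ _ _))//; apply: ler_sum => i _; rewrite mxE.
set S := [set _ | _ in _].
have mS : forall z, a <= z <= b -> S (netA_term sigma i (const_mx z) j 0).
  move=> z zab; exists (const_mx z) => //; exists z => //=.
pose f t := netA_term sigma i (const_mx t) j 0.
have mono : nondecreasing_fun f \/ nonincreasing_fun f.
  exact: netA_term_monotone.
have SB : forall x, S x -> exists2 z, a <= z <= b &
    x = netA_term sigma i (const_mx z) j 0.
  by move=> x [w [u uab uw] wx]; exists u; rewrite -?wx -?uw.
have ubS : has_ubound S.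
  exists (Num.max (f a) (f b)) => x /SB[u uab ->].
  by have /andP[] := monotone_bounded mono uab.
have lbS : has_lbound S.
  exists (Num.min (f a) (f b)) => x /SB[u uab ->].
  by have /andP[] := monotone_bounded mono uab.
have := ub_le_sup ubS (mS _ sab); have := ub_le_sup ubS (mS _ tab).
have := ge_inf lbS (mS _ sab); have := ge_inf lbS (mS _ tab).
by rewrite ler_norml; move=> *; apply/andP; split; lra.
Qed.

Lemma netA_map_bounded (R : realType) (sigma : R -> R) (L N : nat)
    (eta : netA R L 1 N) (a b : R) :
  {homo sigma : u v / u <= v} ->
  exists B : R, forall t j, a <= t <= b -> `|netA_map sigma eta t j 0| <= B.
Proof.
move=> hs; have [ab|ab] := leP a b; last first.
  by exists 0 => t j /andP[/le_trans /[apply]]; rewrite leNgt ab.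
exists (\sum_(j < N) (EMVar sigma eta [set const_mx z | z in `[a, b]] j 0
  + `|netA_map sigma eta a j 0|)) => t j tab.
have aab : a <= a <= b by rewrite lexx.
have H i := netA_map_oscillation eta i hs tab aab.
rewrite (bigD1 j)//= -[leLHS]addr0 lerD//; last first.
  by apply: sumr_ge0 => i _; rewrite addr_ge0// (le_trans _ (H i)).
by rewrite -[X in `|X|](subrK (netA_map sigma eta a j 0))
  (le_trans (ler_normD _ _))// lerD.
Qed.

Lemma measurable_netA_map (R : realType) (sigma : R -> R) (L N : nat)
    (eta : netA R L 1 N) (j : 'I_N) :
  {homo sigma : u v / u <= v} ->
  measurable_fun setT (fun t => netA_map sigma eta t j 0).
Proof.
move=> hs; rewrite [X in measurable_fun _ X](_ : _ =
    (fun t => \sum_(i < netA_size eta) netA_term sigma i (const_mx t) j 0)).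
  apply: measurable_sum => i.
  have [nd|ni] := @netA_term_monotone R sigma L N eta i j hs.
    exact: nondecreasing_measurable.
  exact: nonincreasing_measurable.
by apply/funext => t; rewrite /netA_map /netA_eval summxE.
Qed.

(** * Integrability along a discontinuous curve *)

Lemma measurable_countable_pieces (R : realType) (I : countType)
    (q : R -> I) (g : I -> R -> R) :
  (forall i, measurable [set s | q s = i]) ->
  (forall i, measurable_fun setT (g i)) ->
  measurable_fun setT (fun s => g (q s) s).
Proof.
move=> mq mg _ A mA; rewrite setTI [X in measurable X](_ : _ =
    \bigcup_i ([set s | q s = i] `&` (g i @^-1` A))); last first.
  apply/seteqP; split => [s As|s [i _ [<-]]//]; by exists (q s).
apply: countable_bigcupT_measurable; first exact: countableP.
by move=> i; apply: measurableI => //; rewrite -[X in measurable X]setTI; exact: mg.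
Qed.

Definition grid (R : realType) (N n : nat) (k : {ffun 'I_N -> int}) : 'cV[R]_N :=
  \col_j ((k j)%:~R / n.+1%:R).

Definition grid_index (R : realType) (N n : nat) (v : 'cV[R]_N) :
    {ffun 'I_N -> int} := [ffun j => Num.floor (n.+1%:R * v j 0)].

Lemma grid_index_close (R : realType) (N n : nat) (v : 'cV[R]_N) :
  `|v - grid R n (grid_index n v)| <= n.+1%:R^-1.
Proof.
apply: mx_norm_le => [|j]; first by rewrite invr_ge0.
rewrite !mxE ffunE; set x := v j 0.
have n0 : (0 : R) < n.+1%:R by rewrite ltr0n.
have := floor_itv (n.+1%:R * x) => /andP[l u].
rewrite -(ler_pM2l n0) -[X in X * `|_|]gtr0_norm// -normrM mulrBr.
rewrite [X in _ - X]mulrCA divff ?gt_eqF// ?mulr1.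
rewrite intrD in u.
by rewrite ger0_norm ?subr_ge0//; lra.
Qed.

Lemma measurable_grid_index (R : realType) (N n : nat) (f : R -> 'cV[R]_N) k :
  (forall j, measurable_fun setT (fun s => f s j 0)) ->
  measurable [set s | grid_index n (f s) = k].
Proof.
move=> mf; rewrite [X in measurable X](_ : _ = \bigcap_(j in [set: 'I_N])
   ((fun s => f s j 0) @^-1` `[(k j)%:~R / n.+1%:R, (k j + 1)%:~R / n.+1%:R[)).
  apply: fin_bigcap_measurable => // j _; rewrite -[X in measurable X]setTI.
  exact: mf.
have n0 : (0 : R) < n.+1%:R by rewrite ltr0n.
apply/seteqP; split => s /=.
  move=> <- j _ /=; rewrite ffunE in_itv/= ler_pdivrMr// ltr_pdivlMr// mulrC.
  exact: floor_itv.
move=> H; apply/ffunP => j; rewrite ffunE; apply: floor_def.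
by have := H j I; rewrite /= in_itv/= ler_pdivrMr// ltr_pdivlMr// mulrC.
Qed.

Lemma cvg_pair_nbhs (I : Type) (U V : topologicalType) (H : set_system I)
    (f : I -> U) (g : I -> V) (a : U) (b : V) : Filter H ->
  f @ H --> a -> g @ H --> b -> (f i, g i) @[i --> H] --> (a, b).
Proof.
move=> FH fa gb; exact: (@cvg_pair _ _ _ H (nbhs a) (nbhs b)).
Qed.

(** Rounding [f] to the grid of mesh [1/(n+1)] gives curves with countably many
    values; on the measurable set where such a curve is constant, [G] is a
    continuous function of time.  The rounded curves converge to [f]. *)
Lemma measurable_continuous_comp (R : realType) (N : nat)
    (G : R * 'cV[R]_N -> R) (f : R -> 'cV[R]_N) :
  continuous G -> (forall j, measurable_fun setT (fun s => f s j 0)) ->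
  measurable_fun setT (fun s => G (s, f s)).
Proof.
move=> cG mf.
apply: (@measurable_fun_cvg _ _ _ _
  (fun n s => G (s, grid R n (grid_index n (f s))))).
  move=> n; apply: (@measurable_countable_pieces _ _
    (fun s => grid_index n (f s)) (fun k s => G (s, grid R n k))).
    by move=> k; exact: measurable_grid_index.
  move=> k; apply: continuous_measurable_fun => s.
  apply: (@continuous_comp _ _ _ (fun s => (s, grid R n k)) G); last exact: cG.
  by apply: cvg_pair_nbhs; [exact: cvg_id|exact: cvg_cst].
move=> s _; apply: (@cvg_comp _ _ _ (fun n => (s, grid R n (grid_index n (f s)))) G).
  2: exact: cG.
apply: cvg_pair_nbhs; first exact: cvg_cst.
apply/cvgrPdist_le => e e0; near=> n.
apply: (le_trans (grid_index_close n (f s))); apply: ltW.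
near: n; exact: (near_infty_natSinv_lt (PosNum e0)).
Unshelve. all: by end_near. Qed.

Lemma continuous_coord_comp (R : realType) (N : nat) (T : topologicalType)
    (F : T -> 'cV[R]_N) (j : 'I_N) :
  continuous F -> continuous (fun p => F p j 0).
Proof.
move=> cF p; apply: (@continuous_comp _ _ _ F (fun v => v j 0)).
  exact: cF.
exact: coord_continuous.
Qed.

Lemma continuous_enorm_comp (R : realType) (N : nat) (T : topologicalType)
    (F : T -> 'cV[R]_N) :
  continuous F -> continuous (fun p => enorm (F p)).
Proof.
move=> cF p; rewrite /enorm.
apply: (@continuous_comp _ _ _ (fun p => \sum_(j < N) F p j 0 ^+ 2) Num.sqrt);
  last exact: sqrt_continuous.
move: p; apply: continuous_big; first exact: add_continuous.
move=> j _ p; apply: (@continuous_comp _ _ _ (fun p => F p j 0) (fun x => x ^+ 2)).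
  exact: continuous_coord_comp.
exact: exprn_continuous.
Qed.

(** The box is the transpose of a product of segments, to which Tychonoff's theorem
    applies. *)
Lemma box_compact (R : realType) (N : nat) (B : R) :
  compact [set v : 'cV[R]_N | forall j, `|v j 0| <= B].
Proof.
pose K := [set v : 'rV[R]_N | forall j, `[- B, B]%classic (v ord0 j)].
rewrite [X in compact X](_ : _ = @trmx R 1 N @` K).
  apply: continuous_compact.
    apply: continuous_subspaceT => v A [P vP PA].
    exists (fun i j => P j i) => [i j|w wP].
      by have := vP j i; rewrite mxE.
    by apply: PA => i j; rewrite mxE; exact: wP.
  by apply: (@rV_compact R N (fun=> `[- B, B]%classic)) => i; exact: segment_compact.
apply/seteqP; split => [v vB|_ [v vK <-] j].
  exists v^T; last exact: trmxK.
  by move=> j; rewrite mxE /= in_itv/= -ler_norml.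
by have := vK j; rewrite mxE /= in_itv/= -ler_norml.
Qed.

Lemma continuous_bounded_on_box (R : realType) (N : nat)
    (G : R * 'cV[R]_N -> R) (a b B : R) :
  continuous G -> exists M, forall t (v : 'cV[R]_N), a <= t <= b ->
    (forall j, `|v j 0| <= B) -> `|G (t, v)| <= M.
Proof.
move=> cG; have cK := compact_setX (@segment_compact R a b) (@box_compact R N B).
have /compact_bounded[M [_ /(_ (M + 1))]] :=
  continuous_compact (continuous_subspaceT cG) cK.
rewrite ltrDl ltr01 => /(_ erefl) HM; exists (M + 1) => t v tab vB.
by apply: HM; exists (t, v) => //; split => //=; rewrite in_itv.
Qed.

Lemma integrable_continuous_comp (R : realType) (N : nat)
    (G : R * 'cV[R]_N -> R) (f : R -> 'cV[R]_N) (a b B : R) :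
  continuous G -> (forall j, measurable_fun setT (fun s => f s j 0)) ->
  (forall s j, a <= s <= b -> `|f s j 0| <= B) ->
  lebesgue_measure.-integrable `[a, b] (EFin \o (fun s => G (s, f s))).
Proof.
move=> cG mf fB; have [M HM] := continuous_bounded_on_box a b B cG.
apply: measurable_bounded_integrable => //.
- exact: (compact_finite_measure (@segment_compact _ _ _)).
- apply: (measurable_funS measurableT (@subsetT _ _)).
  exact: measurable_continuous_comp.
- exists M; split; first exact: num_real.
  move=> x Mx s; rewrite /= in_itv/= => sab.
  by rewrite (le_trans _ (ltW Mx))// HM// => j; exact: fB.
Qed.

(** * The exact solution and its Lipschitz tube *)

(** Clearing the denominator of the difference quotient makes the expansion valid
    at [s = t] too, so that continuity and componentwise derivatives follow from
    one inequality. *)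
Lemma has_deriv_within_expansion (R : realType) (N : nat) (A : set R)
    (f : R -> 'cV[R]_N) (t : R) (v : 'cV[R]_N) (e : R) :
  has_deriv_within A f t v -> 0 < e ->
  exists2 d : R, 0 < d & forall s, A s -> `|s - t| < d ->
    `|f s - f t - (s - t) *: v| <= e * `|s - t|.
Proof.
move=> /cvgrPdist_le /[apply] -[d /= d0 H]; exists d => // s As std.
have [->|st] := eqVneq s t; first by rewrite !subrr scale0r subr0 !normr0 mulr0.
have st0 : s - t != 0 by rewrite subr_eq0.
have := H s; rewrite /ball_ /= distrC => /(_ std st As) {}H.
rewrite -[f s - f t](scalerKV st0) -scalerBr normrZ mulrC.
by rewrite ler_wpM2r// distrC.
Qed.

Lemma has_deriv_within_continuous (R : realType) (N : nat) (A : set R)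
    (f g : R -> 'cV[R]_N) :
  (forall t, A t -> has_deriv_within A f t (g t)) -> {within A, continuous f}.
Proof.
move=> fg; apply/subspace_continuousP => t At.
apply/cvgrPdist_le => e e0.
have [d d0 H] := has_deriv_within_expansion (fg t At) ltr01.
pose c := 1 + `|g t|.
have c0 : 0 < c by rewrite ltr_wpDr.
exists (Num.min d (e / c)) => /=.
  by rewrite lt_min d0 divr_gt0.
move=> s /=; rewrite lt_min => /andP[sd se] As.
rewrite distrC in sd; rewrite distrC in se.
have {}H := H s As sd; rewrite distrC -[f s - f t](subrK ((s - t) *: g t)).
rewrite (le_trans (ler_normD _ _))// normrZ.
move: se; rewrite ltr_pdivlMr// => se.
apply: le_trans (ltW se); rewrite /c mulrDr mulr1.
by rewrite lerD2r -[leRHS]mul1r.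
Qed.

Lemma has_deriv_within_is_derive (R : realType) (N : nat) (a b t : R)
    (f : R -> 'cV[R]_N) (v : 'cV[R]_N) (j : 'I_N) :
  has_deriv_within `[a, b] f t v -> a < t < b ->
  is_derive t 1 (fun s => f s j 0) (v j 0).
Proof.
move=> fv /andP[at_ tb].
have H : h^-1 *: ((fun s => f s j 0) (h *: 1 + t) - f t j 0) @[h --> 0^'] --> v j 0.
  apply/cvgrPdist_le => e e0.
  have [d d0 H] := has_deriv_within_expansion fv e0.
  exists (Num.min d (Num.min (t - a) (b - t))) => /=.
    by rewrite !lt_min d0 !subr_gt0 at_.
  move=> h /=; rewrite sub0r normrN !lt_min => /and3P[hd ha hb] h0.
  have hab : `[a, b]%classic (h *: 1 + t).
    rewrite /= in_itv/= [h *: 1]mulr1; move: ha hb; rewrite !ltr_norml; lra.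
  have := H _ hab; rewrite addrK [h *: 1]mulr1 => /(_ hd) {}H.
  have hn0 : 0 < `|h| by rewrite normr_gt0.
  rewrite -(ler_pM2l hn0) -normrM mulrC [leRHS]mulrC; apply: le_trans H.
  apply: le_trans (coord_le_mx_norm _ j); rewrite !mxE distrC mulrC mulrBr.
  set r := f (h + t) j 0 - f t j 0.
  by rewrite (_ : h^-1 *: r = h^-1 * r)// mulrA divff// mul1r.
apply: DeriveDef; first by apply/cvg_ex; exists (v j 0); exact: H.
by apply/cvg_lim => //; exact: H.
Qed.

Lemma integral_has_deriv_within (R : realType) (N : nat) (T a b : R)
    (f g : R -> 'cV[R]_N) (j : 'I_N) :
  (forall t, 0 <= t <= T -> has_deriv_within `[0, T] f t (g t)) ->
  {within `[0, T], continuous g} -> 0 <= a -> a <= b -> b <= T ->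
  Rintegral lebesgue_measure `[a, b] (fun s => g s j 0) = f b j 0 - f a j 0.
Proof.
move=> fg cg a0 ab bT.
have sub : `[a, b]%classic `<=` `[0, T]%classic.
  move=> s /=; rewrite !in_itv/=; lra.
have cj (h : R -> 'cV[R]_N) : {within `[0, T], continuous h} ->
    {within `[a, b], continuous (fun s => h s j 0 : R)}.
  move=> ch; apply: (continuous_subspaceW sub).
  by apply: (@within_continuous_comp _ _ _ `[0, T]%classic h (fun v => v j 0)) => // v _;
    exact: coord_continuous.
have cf : {within `[0, T], continuous f}.
  by apply: (@has_deriv_within_continuous _ _ _ _ g) => t; rewrite /= in_itv/=; exact: fg.
move: ab; rewrite le_eqVlt => /predU1P[<-|ab].
  by rewrite set_itv1 Rintegral_set1 subrr.
rewrite /Rintegral (@continuous_FTC2 _ _ (fun s => f s j 0)) //.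
- exact: cj.
- have [cfab fa fb] := (continuous_within_itvP (fun s => f s j 0 : R) ab).1 (cj _ cf).
  split => // t /[!in_itv]/= tab.
  have [] := @has_deriv_within_is_derive R N 0 T t f (g t) j (fg t _) _ => //; lra.
- move=> t /[!in_itv]/= tab; rewrite derive1E.
  have [] := @has_deriv_within_is_derive R N 0 T t f (g t) j (fg t _) _ => //; lra.
Qed.

Lemma within_continuous_graph (R : realType) (N : nat) (A : set R)
    (F : R * 'cV[R]_N -> 'cV[R]_N) (y : R -> 'cV[R]_N) :
  continuous F -> {within A, continuous y} ->
  {within A, continuous (fun s => F (s, y s))}.
Proof.
move=> cF /subspace_continuousP cy; apply/subspace_continuousP => t At.
apply: (@cvg_comp _ _ _ (fun s => (s, y s)) F); last exact: cF.
apply: cvg_pair_nbhs; last exact: cy.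
by apply: cvg_within_filter; exact: cvg_id.
Qed.

(** Only differences with [y t] at the same time matter, so compactness of [0, T]
    suffices: near each time the local Lipschitz constant and the inverse of the
    local radius are both below [l] for [l] large, and the near-covering form of
    compactness makes one [l] work everywhere. *)
Lemma lipschitz_tube (R : realType) (N : nat) (T : R)
    (F : R * 'cV[R]_N -> 'cV[R]_N) (y : R -> 'cV[R]_N) :
  loc_lipschitz_snd F -> {within `[0, T], continuous y} ->
  exists2 l : R, 0 < l & forall t x, 0 <= t <= T -> enorm (x - y t) <= l^-1 ->
    enorm (F (t, x) - F (t, y t)) <= l * enorm (x - y t).
Proof.
move=> lF /subspace_continuousP cy.
have /compact_near_coveringP := @segment_compact R 0 T.
move=> /(_ R +oo%R (fun l t => 0 <= t <= T -> forall x, enorm (x - y t) <= l^-1 ->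
    enorm (F (t, x) - F (t, y t)) <= l * enorm (x - y t))) [].
  move=> t tT; have [U [k [nU HU]]] := lF (t, y t).
  have [[A B] /= [nA nB] AB] := nU.
  have /nbhs_normP[e /= e0 eB] := nB.
  have e20 : 0 < e / 2 by rewrite divr_gt0.
  have := cy t tT; move=> /cvgrPdist_lt/(_ _ e20) ny.
  have {}ny : \forall s \near t, 0 <= s <= T -> `|y t - y s| < e / 2.
    exact: ny.
  near=> s l => /= sT x xl.
  have l0 : 0 < l by near: l; exact: nbhs_pinfty_gt.
  have kl : k <= l by near: l; apply: nbhs_pinfty_ge; exact: num_real.
  have el : 1 / (e / 2) <= l.
    by near: l; apply: nbhs_pinfty_ge; exact: num_real.
  have ys : `|y t - y s| < e / 2.
    by move: sT; near: s.
  have As : A s by near: s.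
  have yx : `|y t - x| < e.
    rewrite -[y t](subrK (y s)) -addrA (le_lt_trans (ler_normD _ _))//.
    rewrite [e]splitr ltr_leD//.
    apply: mx_norm_le => [|j]; first exact: ltW.
    have := norm_coord_le_enorm (x - y s) j; rewrite !mxE distrC => yx.
    apply: (le_trans yx); apply: (le_trans xl).
    rewrite -(ler_pM2l l0) divff ?gt_eqF//.
    by rewrite -ler_pdivrMr.
  have Us : U (s, x) by apply: AB; split => //; exact: eB.
  have Uy : U (s, y s).
    apply: AB; split => //; apply: eB => /=.
    by apply: lt_trans ys _; rewrite ltr_pdivrMr// mulr2n mulrDr mulr1 ltrDl.
  apply: le_trans (HU _ _ _ Us Uy) _; apply: ler_wpM2r => //.
  exact: enorm_ge0.
Unshelve. all: try by end_near.
move=> M [Mr HM]; exists (Num.max 1 (M + 1)); first by rewrite lt_max ltr01.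
move=> t x tT; apply: (HM _ _ t _ tT x).
  by rewrite lt_max ltrDl ltr01 orbT.
by rewrite /= in_itv.
Qed.

(** * Real induction and integral estimates *)

(** Apply the step at the infimum of the points where [P] fails. *)
Lemma real_induction (R : realType) (a b : R) (P : R -> Prop) :
  (forall t, a <= t <= b -> (forall s, a <= s < t -> P s) ->
    exists2 e, 0 < e & forall t', t <= t' < t + e -> t' <= b -> P t') ->
  forall t, a <= t <= b -> P t.
Proof.
move=> step t tab; apply: contrapT => nPt.
pose bad := [set s | a <= s <= b /\ ~ P s].
have bad_t : bad t by [].
have bad_lb : lbound bad a by move=> s [/andP[]].
have hinf : has_inf bad by split; [exists t|exists a].
have infb : inf bad <= b.
  by rewrite (le_trans (ge_inf _ bad_t))//; [exists a|case/andP: tab].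
have [||e e0 He] := step (inf bad).
- by rewrite infb andbT; apply: lb_le_inf => //; exists t.
- move=> s /andP[as_ sm]; apply: contrapT => nPs.
  have := sm; rewrite ltNge => /negP; apply; apply: ge_inf; first by exists a.
  by split=> //; rewrite as_ (le_trans (ltW sm) infb).
have [x [xab nPx] xe] := inf_adherent e0 hinf.
apply: (nPx); apply: He; last by case/andP: xab.
rewrite xe andbT; apply: ge_inf; first by exists a.
by split.
Qed.

Lemma integrable_continuous_itv (R : realType) (a b : R) (f : R -> R) :
  {within `[a, b], continuous f} ->
  lebesgue_measure.-integrable `[a, b] (EFin \o f).
Proof.
by move=> cf; apply: continuous_compact_integrable => //; exact: segment_compact.
Qed.

Lemma is_derive_expR_primitive (R : realType) (K c x : R) : c != 0 ->
  is_derive x 1 (fun s => K / c * expR (c * s)) (K * expR (c * x)).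
Proof.
move=> c0.
have dc : is_derive x 1 ( *%R c) c.
  have := @is_deriveZ R R R id c x 1 1 _.
  by rewrite [c *: 1]mulr1; apply.
have de := @is_derive1_comp R expR ( *%R c) x _ _ (is_derive_expR _) dc.
have := @is_deriveZ R R R _ (K / c) x 1 _ de.
rewrite (_ : K / c *: (expR (c * x) * c) = K * expR (c * x)) //.
by rewrite [LHS]mulrCA divfK// mulrC.
Qed.

Lemma continuous_scaled_expR (R : realType) (K c : R) :
  continuous (fun s : R => K * expR (c * s)).
Proof.
move=> s; apply: (@continuous_comp _ _ _ (fun s => expR (c * s)) ( *%R K)).
  apply: (@continuous_comp _ _ _ ( *%R c) expR); first exact: mulrl_continuous.
  exact: continuous_expR.
exact: mulrl_continuous.
Qed.

Lemma integral_expR (R : realType) (a b K c : R) : a <= b -> c != 0 ->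
  Rintegral lebesgue_measure `[a, b] (fun s => K * expR (c * s)) =
  K / c * expR (c * b) - K / c * expR (c * a).
Proof.
move=> ab c0.
move: ab; rewrite le_eqVlt => /predU1P[<-|ab].
  by rewrite set_itv1 Rintegral_set1 subrr.
pose G s := K / c * expR (c * s).
have dG (x : R) : is_derive x 1 G (K * expR (c * x)) by exact: is_derive_expR_primitive.
have cG : {within `[a, b], continuous G}.
  by apply: derivable_within_continuous => x _; have [] := dG x.
rewrite /Rintegral (@continuous_FTC2 _ _ G)//.
- by apply: continuous_subspaceT; exact: continuous_scaled_expR.
- have [_ Ga Gb] := (continuous_within_itvP G ab).1 cG.
  by split => // x _; have [] := dG x.
- by move=> x _; rewrite derive1E; have [] := dG x.
Qed.

Lemma Rintegral_cst_itv (R : realType) (a b M : R) : a <= b ->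
  Rintegral lebesgue_measure `[a, b] (fun=> M) = M * (b - a).
Proof.
move=> ab; rewrite Rintegral_cst//= lebesgue_measure_itv/= lte_fin.
by case: ltgtP ab => //= -> _; rewrite subrr.
Qed.

(** The hypothesis leaves out the right end point, which is where the error is not
    yet under control when the lemma is used; a point has measure zero. *)
Lemma integral_le_expR (R : realType) (a b K c : R) (f h : R -> R) :
  a <= b -> c != 0 ->
  lebesgue_measure.-integrable `[a, b] (EFin \o f) ->
  lebesgue_measure.-integrable `[a, b] (EFin \o h) ->
  (forall s, a <= s < b -> `|f s| <= h s + K * expR (c * s)) ->
  `|Rintegral lebesgue_measure `[a, b] f| <=
  Rintegral lebesgue_measure `[a, b] h +
  (K / c * expR (c * b) - K / c * expR (c * a)).
Proof.
move=> ab c0 intf inth fh.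
have inte : lebesgue_measure.-integrable `[a, b]
    (EFin \o (fun s => K * expR (c * s))).
  apply: integrable_continuous_itv; apply: continuous_subspaceT.
  exact: continuous_scaled_expR.
have sub : `[a, b[%classic `<=` `[a, b]%classic.
  by apply: subset_itvl; rewrite bnd_simp.
have S g : lebesgue_measure.-integrable `[a, b] (EFin \o g) ->
    lebesgue_measure.-integrable `[a, b[ (EFin \o g).
  by apply: integrableS.
rewrite -integral_expR// -!Rintegral_itv_bndo_bndc; try exact: S.
rewrite -RintegralD//; try exact: S.
apply: le_trans (le_normr_Rintegral _ _) _ => //; first exact: S.
apply: le_Rintegral => //.
- exact: integrable_norm (S _ intf).
- rewrite (_ : EFin \o _ = (EFin \o h) \+ (EFin \o (fun s => K * expR (c * s)))) //.
  by apply: integrableD => //; exact: S.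
Qed.

(** Over one full subinterval the increment of the error is the sum of the loss
    term, the quadrature error, and the integral of [f1 - f2]. *)
Lemma error_full_step (R : realType) (N : nat) (eta y f1 f2 : R -> 'cV[R]_N)
    (a b c K Eint : R) (I : 'cV[R]_N) (j : 'I_N) :
  a <= b -> c != 0 ->
  lebesgue_measure.-integrable `[a, b] (EFin \o (fun s => f1 s j 0)) ->
  lebesgue_measure.-integrable `[a, b] (EFin \o (fun s => f2 s j 0)) ->
  (forall s, a <= s < b -> `|f1 s j 0 - f2 s j 0| <= K * expR (c * s)) ->
  Rintegral lebesgue_measure `[a, b] (fun s => f2 s j 0) = y b j 0 - y a j 0 ->
  enorm (I - vintegral a b f1) <= Eint ->
  `|eta b j 0 - y b j 0| <= `|eta a j 0 - y a j 0| +
    (enorm (eta b - eta a - I) + Eint) +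
    (K / c * expR (c * b) - K / c * expR (c * a)).
Proof.
move=> ab c0 int1 int2 f12 yE IE.
have H : `|Rintegral lebesgue_measure `[a, b] (fun s => f1 s j 0 - f2 s j 0)| <=
    K / c * expR (c * b) - K / c * expR (c * a).
  have := @integral_le_expR R a b K c (fun s => f1 s j 0 - f2 s j 0) (fun=> 0) ab c0.
  rewrite Rintegral_cst//= mul0r add0r; apply.
  - have := @integrableB _ _ _ lebesgue_measure `[a, b] _ _ _ int1 int2.
    by apply.
  - by apply: integrable_continuous_itv => ?; exact: cvg_cst.
  - by move=> s sab; rewrite add0r f12.
rewrite RintegralB// yE in H.
have H1 := norm_coord_le_enorm (eta b - eta a - I) j.
have H2 := norm_coord_le_enorm (I - vintegral a b f1) j.
move: H1 H2 H; rewrite !mxE; set J := Rintegral _ _ _ => H1 H2 H.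
have {}H2 := le_trans H2 IE.
rewrite (_ : eta b j 0 - y b j 0 = (eta a j 0 - y a j 0) +
  ((eta b j 0 - eta a j 0 - I j 0) + (I j 0 - J)) + (J - (y b j 0 - y a j 0))).
  by do ![rewrite (le_trans (ler_normD _ _))// lerD//].
by ring.
Qed.

(** If the integral of [enorm f1] over the subinterval is small, [f2] is estimated
    by [enorm f1] plus the difference; if the subinterval is short, by [M]. *)
Lemma error_partial_step (R : realType) (N : nat) (eta y f1 f2 : R -> 'cV[R]_N)
    (a b t c K M Evar Estep : R) (j : 'I_N) :
  a <= t <= b -> c != 0 -> 0 <= M -> 0 <= Estep ->
  lebesgue_measure.-integrable `[a, b] (EFin \o (fun s => enorm (f1 s))) ->
  lebesgue_measure.-integrable `[a, b] (EFin \o (fun s => f2 s j 0)) ->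
  0 <= K ->
  (forall s, a <= s < t -> `|f1 s j 0 - f2 s j 0| <= K * expR (c * s)) ->
  (forall s, a <= s < t -> `|f2 s j 0| <= M) ->
  Rintegral lebesgue_measure `[a, t] (fun s => f2 s j 0) = y t j 0 - y a j 0 ->
  `|eta t j 0 - eta a j 0| <= Evar ->
  Rintegral lebesgue_measure `[a, b] (fun s => enorm (f1 s)) <= Estep \/
    b - a <= Estep ->
  `|eta t j 0 - y t j 0| <= `|eta a j 0 - y a j 0| + Evar + (1 + M) * Estep +
    (K / c * expR (c * t) - K / c * expR (c * a)).
Proof.
move=> /andP[at_ tb] c0 M0 Es0 int1 int2 K0 f12 f2M yE etaE step.
have sub : `[a, t]%classic `<=` `[a, b]%classic.
  by apply: subset_itvl; rewrite bnd_simp.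
have S g : lebesgue_measure.-integrable `[a, b] (EFin \o g) ->
    lebesgue_measure.-integrable `[a, t] (EFin \o g).
  by apply: integrableS.
suff H : `|y t j 0 - y a j 0| <= (1 + M) * Estep +
    (K / c * expR (c * t) - K / c * expR (c * a)).
  rewrite (_ : eta t j 0 - y t j 0 = (eta a j 0 - y a j 0) +
    (eta t j 0 - eta a j 0) - (y t j 0 - y a j 0)); last by ring.
  rewrite -[leRHS]addrA (le_trans (ler_normB _ _))// lerD//.
  by rewrite (le_trans (ler_normD _ _))// lerD.
rewrite -yE; case: step => [ih|ba].
  apply: le_trans (@integral_le_expR _ _ _ K c _ (fun s => enorm (f1 s)) at_ c0 _ _ _) _.
  - exact: S.
  - exact: S.
  - move=> s sat; rewrite -[f2 s j 0](subKr (f1 s j 0)).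
    rewrite (le_trans (ler_normB _ _))// lerD// ?f12//.
    exact: norm_coord_le_enorm.
  - rewrite lerD2r mulrDl mul1r ler_wpDr ?mulr_ge0//; apply: le_trans ih.
    apply: fine_le; [exact: integrable_fin_num (S _ int1)|
      exact: integrable_fin_num int1|].
    apply: ge0_subset_integral => //.
    - by have /integrableP[] := int1.
    - by move=> s _; rewrite lee_fin enorm_ge0.
have H : Rintegral lebesgue_measure `[a, t] (fun=> M) <= (1 + M) * Estep.
  rewrite Rintegral_cst_itv//.
  have : M * (t - a) <= M * Estep by rewrite ler_wpM2l//; lra.
  lra.
apply: le_trans (@integral_le_expR _ _ _ K c _ (fun=> M) at_ c0 _ _ _) _.
- exact: S.
- by apply: integrable_continuous_itv => ?; exact: cvg_cst.
- by move=> s sat; rewrite ler_wpDr ?f2M// mulr_ge0 ?expR_ge0.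
- by rewrite lerD2r.
Qed.

(** * Error propagation along the partition *)

Lemma node_le (R : realType) (T : R) (s : seq R) (k : nat) :
  itv_partition 0 T s -> (k < size s)%N -> node s k <= node s k.+1.
Proof. by move=> [/(pathP 0) ps _] ks; exact/ltW/ps. Qed.

Lemma node_bounds (R : realType) (T : R) (s : seq R) (k : nat) :
  itv_partition 0 T s -> (k <= size s)%N -> 0 <= node s k <= T.
Proof.
move=> ps ks; rewrite /node (set_nth_default T) ?ltnS//.
by rewrite (itv_partition_nth_ge _ ps) ?(itv_partition_nth_le _ ps) ?ltnS.
Qed.

Lemma node_size (R : realType) (T : R) (s : seq R) :
  itv_partition 0 T s -> node s (size s) = T.
Proof. exact: itv_partition_nth_size. Qed.

(** A time interval just to the right of [t] shares a partition interval with [t];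
    at [t = T] there is nothing to the right. *)
Lemma node_locate (R : realType) (T t : R) (s : seq R) :
  itv_partition 0 T s -> 0 < T -> 0 <= t <= T ->
  exists k : nat, exists2 e : R, (k < size s)%N & [/\ 0 < e, node s k <= t &
    forall t', t <= t' < t + e -> t' <= T -> t' <= node s k.+1].
Proof.
move=> ps T0 /andP[t0 tT].
have below m : t < node s m -> (m <= size s)%N -> exists2 k : nat,
    (k < size s)%N & node s k <= t < node s k.+1.
  elim: m => [|m IH]; first by rewrite /node/= ltNge t0.
  move=> tm ms; have [tm'|mt] := ltP t (node s m); first exact: IH (ltnW ms).
  by exists m => //; rewrite mt.
move: tT; rewrite le_eqVlt => /predU1P[tT|tT].
  have s0 : (0 < size s)%N.
    rewrite lt0n; apply: contra_ltN T0 => /eqP s0.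
    by rewrite -(node_size ps) s0.
  exists (size s).-1, 1; rewrite ?prednK//; split => //.
    by rewrite tT; have /andP[] := node_bounds ps (leq_pred _).
  by move=> t' _; rewrite (node_size ps).
have [||k ks /andP[kt tk]] := below (size s); rewrite ?(node_size ps)//.
exists k, (node s k.+1 - t) => //; split => //; first by rewrite subr_gt0.
by move=> t' /andP[_]; rewrite addrC subrK => /ltW.
Qed.

Lemma error_at_node (R : realType) (N : nat) (T c K Eint : R)
    (eta y f1 f2 : R -> 'cV[R]_N) (s : seq R) (I : R -> R -> 'cV[R]_N)
    (j : 'I_N) (k : nat) :
  itv_partition 0 T s -> c != 0 -> (k <= size s)%N ->
  lebesgue_measure.-integrable `[0, T] (EFin \o (fun s => f1 s j 0)) ->
  lebesgue_measure.-integrable `[0, T] (EFin \o (fun s => f2 s j 0)) ->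
  (forall a b, 0 <= a -> a <= b -> b <= T ->
    Rintegral lebesgue_measure `[a, b] (fun s => f2 s j 0) = y b j 0 - y a j 0) ->
  (forall i, (i < size s)%N -> enorm (I (node s i) (node s i.+1) -
     vintegral (node s i) (node s i.+1) f1) <= Eint) ->
  (forall t, 0 <= t < node s k -> `|f1 t j 0 - f2 t j 0| <= K * expR (c * t)) ->
  `|eta (node s k) j 0 - y (node s k) j 0| <= `|eta 0 j 0 - y 0 j 0| +
    \sum_(i < k) (enorm (eta (node s i.+1) - eta (node s i)
                    - I (node s i) (node s i.+1)) + Eint) +
    (K / c * expR (c * node s k) - K / c).
Proof.
move=> ps c0 + int1 int2 yE IE; elim: k => [|k IH] ks f12.
  by rewrite big_ord0 /node/= mulr0 expR0 mulr1 subrr !addr0.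
have kk := node_le ps ks.
have /andP[k0 _] := node_bounds ps (ltnW ks).
have /andP[_ kT] := node_bounds ps ks.
have S g : lebesgue_measure.-integrable `[0, T] (EFin \o g) ->
    lebesgue_measure.-integrable `[node s k, node s k.+1] (EFin \o g).
  apply: integrableS => //; apply: subset_itv; by rewrite bnd_simp.
have {}IH := IH (ltnW ks) _.
apply: le_trans (@error_full_step R N eta y f1 f2 _ _ c K Eint
  (I (node s k) (node s k.+1)) j kk c0 (S _ int1) (S _ int2) _ _ (IE _ ks)) _.
- by move=> t /andP[kt tk]; apply: f12; rewrite tk (le_trans k0).
- exact: yE.
rewrite big_ord_recr/=.
have : forall t, 0 <= t < node s k -> `|f1 t j 0 - f2 t j 0| <= K * expR (c * t).
  by move=> t /andP[t0 tk]; apply: f12; rewrite t0 (lt_le_trans tk).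
move=> /IH; set X := \sum_(i < k) _; lra.
Qed.

(** The term [K / c * expR (c * t)] is what is left of the integral of the assumed
    exponential bound; it is a small fraction of that bound when [c] is large. *)
Lemma error_improvement (R : realType) (N : nat) (T t c K M Evar Estep Eint Eloss : R)
    (eta y f1 f2 : R -> 'cV[R]_N) (y0 : 'cV[R]_N) (s : seq R)
    (I : R -> R -> 'cV[R]_N) (j : 'I_N) (k : nat) :
  itv_partition 0 T s -> 0 < c -> 0 <= K -> 0 <= M -> 0 <= Estep -> 0 <= Eint ->
  y 0 = y0 -> (k < size s)%N -> node s k <= t <= node s k.+1 ->
  lebesgue_measure.-integrable `[0, T] (EFin \o (fun s => f1 s j 0)) ->
  lebesgue_measure.-integrable `[0, T] (EFin \o (fun s => enorm (f1 s))) ->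
  lebesgue_measure.-integrable `[0, T] (EFin \o (fun s => f2 s j 0)) ->
  (forall a b, 0 <= a -> a <= b -> b <= T ->
    Rintegral lebesgue_measure `[a, b] (fun s => f2 s j 0) = y b j 0 - y a j 0) ->
  (forall a, 0 <= a <= T -> `|f2 a j 0| <= M) ->
  (forall i, (i < size s)%N -> enorm (I (node s i) (node s i.+1) -
     vintegral (node s i) (node s i.+1) f1) <= Eint) ->
  \sum_(i < size s) enorm (eta (node s i.+1) - eta (node s i)
     - I (node s i) (node s i.+1)) + enorm (eta 0 - y0) <= Eloss ->
  `|eta t j 0 - eta (node s k) j 0| <= Evar ->
  Rintegral lebesgue_measure `[node s k, node s k.+1] (fun s => enorm (f1 s)) <= Estep \/
    node s k.+1 - node s k <= Estep ->
  (forall a, 0 <= a < t -> `|f1 a j 0 - f2 a j 0| <= K * expR (c * a)) ->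
  `|eta t j 0 - y t j 0| <= Eloss + (size s)%:R * Eint + Evar + (1 + M) * Estep +
    K / c * expR (c * t).
Proof.
move=> ps c0 K0 M0 Es0 Ei0 y0E ks /andP[kt tk] int1 intn int2 yE f2M IE.
move=> loss etaE step f12.
have cn0 : c != 0 by rewrite gt_eqF.
have /andP[k0 _] := node_bounds ps (ltnW ks).
have /andP[_ kT] := node_bounds ps ks.
have S g : lebesgue_measure.-integrable `[0, T] (EFin \o g) ->
    lebesgue_measure.-integrable `[node s k, node s k.+1] (EFin \o g).
  by apply: integrableS => //; apply: subset_itv; rewrite bnd_simp.
have P := @error_partial_step R N eta y f1 f2 (node s k) (node s k.+1) t c K M
  Evar Estep j _ cn0 M0 Es0 (S _ intn) (S _ int2) K0 _ _ _ etaE step.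
have f12k a : 0 <= a < node s k -> `|f1 a j 0 - f2 a j 0| <= K * expR (c * a).
  by move=> /andP[a0 ak]; apply: f12; rewrite a0 (lt_le_trans ak).
have Q := error_at_node eta ps cn0 (ltnW ks) int1 int2 yE IE f12k.
apply: le_trans (P _ _ _ _) _.
- by rewrite kt.
- by move=> a /andP[ka at_]; apply: f12; rewrite at_ (le_trans k0).
- move=> a /andP[ka at_]; apply: f2M; rewrite (le_trans k0)//=.
  by rewrite (le_trans (ltW at_))// (le_trans tk).
- by apply: yE => //; rewrite (le_trans tk).
have d0 : `|eta 0 j 0 - y 0 j 0| <= enorm (eta 0 - y0).
  by have := norm_coord_le_enorm (eta 0 - y0) j; rewrite y0E !mxE.
have sumE : \sum_(i < k) (enorm (eta (node s i.+1) - eta (node s i)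
                    - I (node s i) (node s i.+1)) + Eint) <=
   \sum_(i < size s) enorm (eta (node s i.+1) - eta (node s i)
     - I (node s i) (node s i.+1)) + (size s)%:R * Eint.
  rewrite big_split/= sumr_const card_ord -[Eint *+ k]mulr_natl lerD//.
    rewrite -!(big_mkord xpredT (fun i => enorm (eta (node s i.+1) - eta (node s i)
     - I (node s i) (node s i.+1)))).
    rewrite [leRHS](big_cat_nat _ (ltnW ks))//= lerDl.
    by apply: sumr_ge0 => i _; exact: enorm_ge0.
  by rewrite ler_wpM2r// ler_nat ltnW.
have Kc : 0 <= K / c by rewrite divr_ge0// ltW.
move: Q loss d0 sumE.
set X := \sum_(i < k) _; set Y := \sum_(i < size s) _; lra.
Qed.

(** * The error bound *)

Lemma within_continuous_coord_bounded (R : realType) (N : nat) (a b : R)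
    (f : R -> 'cV[R]_N) :
  {within `[a, b], continuous f} ->
  exists2 M, 0 <= M & forall t j, a <= t <= b -> `|f t j 0| <= M.
Proof.
move=> cf.
have /compact_bounded[M [_ HM]] := continuous_compact cf (@segment_compact R a b).
exists (Num.max 0 (M + 1)) => [|t j tab]; first by rewrite le_max lexx.
apply: le_trans (coord_le_mx_norm _ j) _; apply: HM.
  by rewrite lt_max ltrDl ltr01 orbT.
by exists t => //=; rewrite in_itv.
Qed.

Theorem theoremC1 (R : realType) (N : nat) (T : R) (y0 : 'cV[R]_N)
    (F : R * 'cV[R]_N -> 'cV[R]_N) (y : R -> 'cV[R]_N)
    (T_gt0 : 0 < T)
    (F_cont : continuous F)
    (F_lip : loc_lipschitz_snd F)
    (y_C1 : C1_on `[0, T] y)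
    (y_ode : forall t : R, 0 <= t <= T ->
       has_deriv_within `[0, T] y t (F (t, y t)))
    (y_init : y 0 = y0) :
  exists C C' : R, 0 < C /\ 0 < C' /\
    forall (sigma : R -> R) (L : nat) (eta : netA R L 1 N)
      (Evar Estep Eint Eloss : R) (s : seq R) (I : R -> R -> 'cV[R]_N),
      {homo sigma : u v / u <= v} ->
      0 < Evar -> 0 < Estep -> 0 < Eint ->
      admissible_partition T F sigma eta Evar Estep s ->
      approx_integral F sigma eta Eint s I ->
      Loss y0 sigma eta s I <= Eloss ->
      Eloss + (size s)%:R * Eint + Evar + Estep < C' ->
      forall t : R, 0 <= t <= T ->
        enorm (netA_map sigma eta t - y t) <=
          C * (Eloss + (size s)%:R * Eint + Evar + Estep).
Proof.
have cy : {within `[0, T], continuous y}.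
  apply: (@has_deriv_within_continuous _ _ _ _ (fun t => F (t, y t))) => t.
  by rewrite /= in_itv/=; exact: y_ode.
have cFy := within_continuous_graph F_cont cy.
have [l l0 tube] := lipschitz_tube F_lip cy.
have [M M0 FyM] := within_continuous_coord_bounded cFy.
pose n : R := N.+1%:R.
have n1 : 1 <= n by rewrite ler1n.
(* [c] and [A] are such that, after summing over the components, each of the four
   contributions to the error just after [t] (tolerances, integral, oscillation
   of eta, increment of y) is at most a quarter of [B * expR (c * t)]. *)
pose c := 4 * n * l.
pose A := 4 * n * (1 + M).
have c0 : 0 < c by rewrite /c !mulr_gt0//; lra.
have A0 : 0 < A by rewrite /A !mulr_gt0//; lra.
pose C := A * expR (c * T).
have C0 : 0 < C by rewrite mulr_gt0// expR_gt0.
exists C, (l^-1 / C); split=> //; split; first by rewrite divr_gt0// invr_gt0.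
move=> sigma L eta Evar Estep Eint Eloss s I hs Evar0 Estep0 Eint0 [ps adm] appr loss.
set delta := _ + Estep => deltaC.
pose h := netA_map sigma eta.
have loss0 : 0 <= Eloss.
  apply: le_trans loss; rewrite addr_ge0 ?enorm_ge0//.
  by apply: sumr_ge0 => i _; exact: enorm_ge0.
have szE : 0 <= (size s)%:R * Eint by rewrite mulr_ge0// ltW.
have delta0 : 0 < delta by rewrite /delta; lra.
pose B := A * delta.
have B0 : 0 < B by rewrite mulr_gt0.
(* The claimed bound keeps eta inside the tube of radius [l^-1]. *)
have Bl t : t <= T -> B * expR (c * t) <= l^-1.
  move=> tT; rewrite (@le_trans _ _ (delta * C))//; last first.
    by rewrite -ler_pdivlMr// ltW.
  rewrite /B /C mulrAC [leRHS]mulrC (ler_wpM2r (ltW delta0))//.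
  by rewrite ler_pM2l// ler_expR ler_wpM2l// ltW.
suff good : forall t, 0 <= t <= T -> enorm (h t - y t) <= B * expR (c * t).
  move=> t tT; apply: le_trans (good t tT) _.
  rewrite /B /C mulrAC (ler_wpM2r (ltW delta0))// ler_pM2l// ler_expR.
  by rewrite ler_wpM2l ?(ltW c0)//; case/andP: tT.
apply: real_induction => t tT good.
have [k [e ks [e0 kt etk]]] := node_locate ps T_gt0 tT.
have [EM step] := adm k ks.
have meas j := measurable_netA_map eta j hs.
have [Bh hB] := netA_map_bounded eta 0 T hs.
have {}hB u j : 0 <= u <= T -> `|h u j 0| <= Bh by exact: hB.
have int1 j :=
  integrable_continuous_comp (continuous_coord_comp (j := j) F_cont) meas hB.
have intn := integrable_continuous_comp (continuous_enorm_comp F_cont) meas hB.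
have yI j a b := @integral_has_deriv_within R N T a b y (fun t => F (t, y t)) j y_ode cFy.
have int2 j : lebesgue_measure.-integrable `[0, T]
    (EFin \o (fun s => F (s, y s) j 0)).
  apply: integrable_continuous_itv.
  apply: (@within_continuous_comp _ _ _ `[0, T]%classic
    (fun s => F (s, y s)) (fun v => v j 0)) => // v _; exact: coord_continuous.
pose X := Eloss + (size s)%:R * Eint + Evar + (1 + M) * Estep +
    l * B / c * expR (c * t).
have ttk : t <= node s k.+1.
  by apply: etk; [rewrite lexx ltrDl|case/andP: tT].
have tk : node s k <= t <= node s k.+1 by rewrite kt.
have at_t j : `|h t j 0 - y t j 0| <= X.
  apply: (@error_improvement R N T t c (l * B) M Evar Estep Eint Eloss h y
    (fun u => F (u, h u)) (fun u => F (u, y u)) y0 s I j k) => //; try exact: ltW.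
  - by rewrite mulr_ge0// ltW.
  - by move=> a b; exact: yI.
  - by move=> u uT; exact: FyM.
  - apply: le_trans (EM j); apply: netA_map_oscillation => //.
    by rewrite lexx (le_trans kt).
  - move=> u /andP[u0 ut].
    have uT : 0 <= u <= T by rewrite u0 (le_trans (ltW ut))//; case/andP: tT.
    have gu := good u; rewrite u0 ut in gu; have {}gu := gu isT.
    have := norm_coord_le_enorm (F (u, h u) - F (u, y u)) j; rewrite !mxE => H.
    apply: (le_trans H).
    apply: le_trans (tube u (h u) uT _) _.
      by apply: le_trans gu _; apply: Bl; case/andP: uT.
    by rewrite -mulrA ler_pM2l.
(* On a time step of length [e'] eta stays in the same partition interval and y
   moves by a fraction of [B]. *)
pose e' := Num.min e (B / (4 * n * (1 + M))).
exists e'; first by rewrite lt_min e0 divr_gt0.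
move=> t' /andP[tt' te'] t'T.
have t'e : t' - t < e /\ t' - t < B / (4 * n * (1 + M)).
  by apply/andP; rewrite -lt_min -/e' ltrBlDl.
have t'k : t' <= node s k.+1.
  by apply: etk => //; rewrite tt'/= -ltrBlDl; case: t'e.
have t0 : 0 <= t by case/andP: tT.
have yM j : `|y t' j 0 - y t j 0| <= M * (t' - t).
  rewrite -yI//.
  have tt'sub : `[t, t']%classic `<=` `[0, T]%classic.
    by apply: subset_itv; rewrite bnd_simp.
  have := @integral_le_expR R t t' 0 c (fun u => F (u, y u) j 0) (fun=> M) tt'
    (lt0r_neq0 c0) _ _ _.
  rewrite Rintegral_cst_itv// !mul0r subrr addr0; apply=> //.
  - by apply: integrableS (int2 j).
  - by apply: integrable_continuous_itv => ?; exact: cvg_cst.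
  move=> u /andP[tu ut']; rewrite mul0r addr0 FyM// (le_trans t0)//=.
  by rewrite (le_trans (ltW ut')).
have hE j : `|h t' j 0 - h t j 0| <= Evar.
  apply: le_trans (EM j); apply: netA_map_oscillation => //.
  by rewrite t'k andbT (le_trans kt).
pose X' := X + Evar + M * (t' - t).
have X'0 : 0 <= X'.
  have lBc0 : 0 <= l * B / c * expR (c * t).
    by rewrite mulr_ge0 ?expR_ge0// divr_ge0 ?(ltW c0)// mulr_ge0// ltW.
  have MT : 0 <= M * (t' - t) by rewrite mulr_ge0// subr_ge0.
  have ME : 0 <= (1 + M) * Estep by rewrite mulr_ge0 ?(ltW Estep0)//; lra.
  by rewrite /X' /X; lra.
have at_t' j : `|(h t' - y t') j 0| <= X'.
  rewrite !mxE (_ : h t' j 0 - y t' j 0 = (h t j 0 - y t j 0) +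
    (h t' j 0 - h t j 0) - (y t' j 0 - y t j 0)); last by ring.
  rewrite (le_trans (ler_normB _ _))// lerD//.
  by rewrite (le_trans (ler_normD _ _))// lerD.
apply: le_trans (enorm_le X'0 at_t') _.
have Nn : N%:R * X' <= n * X' by rewrite ler_wpM2r// ler_nat.
apply: le_trans Nn _.
have E1 : 1 <= expR (c * t).
  by rewrite -expR0 ler_expR mulr_ge0// ltW.
have E2 : expR (c * t) <= expR (c * t').
  by rewrite ler_expR ler_pM2l.
have lBc : n * (l * B / c * expR (c * t)) = B / 4 * expR (c * t).
  by rewrite mulrA /c; congr (_ * _); field; apply/andP; split; lra.
have nX : n * (Eloss + (size s)%:R * Eint + Evar + (1 + M) * Estep) <= B / 4.
  rewrite (_ : B / 4 = n * ((1 + M) * delta)); last by rewrite /B /A; field.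
  apply: ler_wpM2l; first lra.
  rewrite /delta; nra.
have nE : n * Evar <= B / 4.
  apply: le_trans nX; apply: ler_wpM2l; first lra.
  have ME : 0 <= (1 + M) * Estep by rewrite mulr_ge0 ?(ltW Estep0)//; lra.
  lra.
have nM : n * (M * (t' - t)) <= B / 4.
  have [_] := t'e; rewrite ltr_pdivlMr => [H|]; last by rewrite !mulr_gt0//; lra.
  have : 0 <= n * (t' - t) by rewrite mulr_ge0 ?subr_ge0//; lra.
  nra.
have -> : n * X' = n * (Eloss + (size s)%:R * Eint + Evar + (1 + M) * Estep) +
  n * (l * B / c * expR (c * t)) + n * Evar + n * (M * (t' - t)).
  by rewrite /X' /X; ring.
rewrite lBc; nra.
Qed.
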